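(* Unless ETH is false, there is no algorithm that, given a CNF-formula $\phi$ with $n$ variables and primal treewidth $k$ and a clause $C$ of $\phi$, decides whether $C$ is in a MUS of $\phi$ in time $2^{2^{o(k)}}2^{o(n)}$.
   Context: The Exponential Time Hypothesis (ETH) states that there is no algorithm for 3SAT with runtime $2^{o(N)}$, where $N$ is the number of variables of the input formula. A minimal unsatisfiable set (MUS) of a CNF-formula $\phi$ is an unsatisfiable set $\mathcal C$ of clauses of $\phi$ such that every proper subset of $\mathcal C$ is satisfiable. The primal graph of a CNF-formula has the variables as vertices, two of them being adjacent iff they appear together in a clause; the primal treewidth is the treewidth of the primal graph. *)

(* Defs.v *)
From mathcomp Require Import all_boot.

Set Implicit Arguments.
Unset Strict Implicit.
Unset Printing Implicit Defensive.

(* ** CNF formulas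

   A formula is a set of clauses and a clause a set of literals; the literal
   (i, true) is the variable i and (i, false) its negation.  A clause may be
   empty and may contain complementary literals. *)

Definition lit (n : nat) : finType := ('I_n * bool)%type.
Definition clause (n : nat) : finType := {set lit n}.
Definition cnf (n : nat) : finType := {set clause n}.

Definition sat_clause n (a : {ffun 'I_n -> bool}) (c : clause n) : bool :=
  [exists l in c, a l.1 == l.2].

Definition sat n (phi : cnf n) : bool :=
  [exists a : {ffun 'I_n -> bool}, [forall c in phi, sat_clause a c]].

Definition clause_vars n (c : clause n) : {set 'I_n} :=
  [set l.1 | l in c].

Definition cnf_vars n (phi : cnf n) : {set 'I_n} :=
  \bigcup_(c in phi) clause_vars c.

(* phi : cnf n only says that the variables are among 0, ..., n - 1; under
   this hypothesis n is the number of variables of phi. *)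
Definition all_vars_occur n (phi : cnf n) : Prop := cnf_vars phi = [set: 'I_n].

Definition is_3cnf n (phi : cnf n) : Prop :=
  forall c : clause n, c \in phi -> #|c| <= 3.

Definition is_MUS n (phi M : cnf n) : Prop :=
  [/\ M \subset phi,
      ~~ sat M
    & forall D : cnf n, D \proper M -> sat D].

Definition in_some_MUS n (phi : cnf n) (c : clause n) : Prop :=
  exists2 M : cnf n, is_MUS phi M & c \in M.

(* ** Treewidth *)

(* ucycle also accepts the sequence [:: x; y] for an edge xy, so a genuine
   cycle is one of length at least 3. *)
Definition is_tree (U : finType) (t : rel U) : Prop :=
  [/\ 0 < #|U|,
      symmetric t,
      irreflexive t,
      forall x y : U, connect t x y
    & forall p : seq U, ucycle t p -> size p <= 2].

Definition is_tree_decomposition (V : finType) (e : rel V)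
    (U : finType) (t : rel U) (bag : U -> {set V}) : Prop :=
  [/\ is_tree t,
      forall v : V, exists x : U, v \in bag x,
      forall v w : V, e v w -> exists x : U, (v \in bag x) && (w \in bag x)
    & forall (v : V) (x y : U), v \in bag x -> v \in bag y ->
        connect [rel x' y' | [&& t x' y', v \in bag x' & v \in bag y']] x y].

Definition treewidth_le (V : finType) (e : rel V) (k : nat) : Prop :=
  exists (U : finType) (t : rel U) (bag : U -> {set V}),
    is_tree_decomposition e t bag /\ forall x : U, #|bag x| <= k.+1.

(* The graph with no vertices gets treewidth 0. *)
Definition is_treewidth (V : finType) (e : rel V) (k : nat) : Prop :=
  treewidth_le e k /\ forall k' : nat, treewidth_le e k' -> k <= k'.

Definition primal_graph n (phi : cnf n) : rel 'I_n :=
  [rel v w | (v != w) &&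
    [exists c in phi, (v \in clause_vars c) && (w \in clause_vars c)]].

Definition is_primal_treewidth n (phi : cnf n) (k : nat) : Prop :=
  is_treewidth (primal_graph phi) k.

(* ** Algorithms

   The model of computation is the language WHILE of N. D. Jones
   (Computability and Complexity from a Programming Perspective, 1997) with
   its unit-cost time measure.  Data are binary trees built by consing; the
   only test is whether a tree is Nil.  WHILE and Turing machines simulate
   each other with polynomial overhead, and the time classes used below are
   closed under such overhead. *)

Inductive tree : Type := Nil | Cons (a b : tree).

Definition thd (a : tree) : tree := if a is Cons b _ then b else Nil.
Definition ttl (a : tree) : tree := if a is Cons _ b then b else Nil.
Definition is_nil (a : tree) : bool := if a is Nil then true else false.

Inductive expr : Type :=
  | EVar (x : nat)
  | ENil
  | ECons (d e : expr)
  | EHd (e : expr)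
  | ETl (e : expr).

Inductive cmd : Type :=
  | Assign (x : nat) (e : expr)
  | Seq (c d : cmd)
  | While (e : expr) (c : cmd).

Definition store : Type := nat -> tree.

Definition update (s : store) (x : nat) (a : tree) : store :=
  fun y => if y == x then a else s y.

Fixpoint eval (s : store) (e : expr) : tree :=
  match e with
  | EVar x => s x
  | ENil => Nil
  | ECons d e' => Cons (eval s d) (eval s e')
  | EHd e' => thd (eval s e')
  | ETl e' => ttl (eval s e')
  end.

Fixpoint expr_time (e : expr) : nat :=
  match e with
  | EVar _ => 1
  | ENil => 1
  | ECons d e' => (expr_time d + expr_time e').+1
  | EHd e' => (expr_time e').+1
  | ETl e' => (expr_time e').+1
  end.

(* exec c s s' r: started in store s, the command c halts in store s' after
   time r. *)
Inductive exec : cmd -> store -> store -> nat -> Prop :=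
  | exec_assign x e s :
      exec (Assign x e) s (update s x (eval s e)) (expr_time e).+1
  | exec_seq c d s s' s'' r r' :
      exec c s s' r -> exec d s' s'' r' ->
      exec (Seq c d) s s'' (r + r')
  | exec_while_stop e c s :
      is_nil (eval s e) ->
      exec (While e c) s s (expr_time e).+1
  | exec_while_step e c s s' s'' r r' :
      ~~ is_nil (eval s e) ->
      exec c s s' r -> exec (While e c) s' s'' r' ->
      exec (While e c) s s'' ((expr_time e).+1 + r + r').

(* Variable 0 holds both the input and the output. *)
Definition init_store (input : tree) : store :=
  fun x => if x == 0 then input else Nil.

(* On this input, the program p answers the question P within time T; the
   answer is "yes" iff the output is not Nil. *)
Definition answers_within (p : cmd) (input : tree) (T : nat) (P : Prop) : Prop :=
  exists (s : store) (r : nat),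
    [/\ exec p (init_store input) s r,
        r <= T
      & ~~ is_nil (s 0) <-> P].

(* ** Input encoding

   Variables are written in unary.  Sets are written as lists without
   repetition, in arbitrary order: a formula or a clause has several codes,
   and an algorithm has to be correct on all of them. *)

Definition code_nat (i : nat) : tree := iter i (Cons Nil) Nil.

Definition code_bool (b : bool) : tree := if b then Cons Nil Nil else Nil.

Definition code_seq (s : seq tree) : tree := foldr Cons Nil s.

Definition code_lit n (l : lit n) : tree :=
  Cons (code_bool l.2) (code_nat l.1).

Definition code_clause n (c : seq (lit n)) : tree :=
  code_seq (map (@code_lit n) c).

Definition is_clause_code n (c : clause n) (a : tree) : Prop :=
  exists2 s : seq (lit n), perm_eq s (enum c) & a = code_clause s.

Definition is_cnf_code n (phi : cnf n) (a : tree) : Prop :=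
  exists s : seq (seq (lit n)),
    [/\ all uniq s,
        perm_eq [seq [set l in c] | c <- s] (enum phi)
      & a = code_seq (map (@code_clause n) s)].

(* ** The Exponential Time Hypothesis *)

(* f(m) = o(m).  Exponents may be taken to be natural numbers because rounding
   a nonnegative real-valued function up does not affect being o(m), and time
   bounds below 1 are void. *)
Definition little_o (f : nat -> nat) : Prop :=
  forall c : nat, exists m0 : nat, forall m : nat, m0 <= m -> c * f m <= m.

Definition solves_3SAT (p : cmd) (T : nat -> nat) : Prop :=
  forall (N : nat) (phi : cnf N) (a : tree),
    is_3cnf phi -> all_vars_occur phi -> is_cnf_code phi a ->
    answers_within p a (T N) (sat phi).

Definition ETH : Prop :=
  ~ exists (p : cmd) (f : nat -> nat),
      little_o f /\ solves_3SAT p (fun N => 2 ^ f N).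

(* T bounds the time in terms of the number of variables and the primal
   treewidth of the formula. *)
Definition solves_MUS_membership (p : cmd) (T : nat -> nat -> nat) : Prop :=
  forall (n : nat) (phi : cnf n) (C : clause n) (k : nat) (a b : tree),
    all_vars_occur phi -> is_primal_treewidth phi k -> C \in phi ->
    is_cnf_code phi a -> is_clause_code C b ->
    answers_within p (Cons a b) (T n k) (in_some_MUS phi C).

(* Main.v *)
(** Let a 3CNF formula have variables [x_i], [i < N], and clauses [c_j],
    [j < M].  Add a variable [z] and [m] variables [y_t], where [M < 2 ^ m],
    and give every [c_j] its own assignment [w_j] of the [y_t].  Consider the
    formula made of the goal clause [z], the unit clauses [x_i] and [~ x_i], a
    clause "if [z] and [y = w_j] then [l]" for every [j] and every literal [l]
    of [c_j], and a clause "not ([z] and [y = w])" for every other [w].  A set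
    of clauses witnessing that [z] is in a MUS becomes satisfiable when [z] is
    removed, so it does not contain both [x_i] and [~ x_i]; being
    unsatisfiable, it refutes each [y = w_j] by falsifying some literal of
    [c_j].  Hence [z] is in a MUS iff some assignment falsifies a literal in
    every [c_j], that is, iff its complement satisfies the 3CNF formula.

    There are [N + m + 1] variables, and since every clause contains at most
    one [x_i], a star of bags [{x_i, z, y_0, ..., y_(m-1)}] shows that the
    treewidth is at most [m + 1].  As [M] is polynomial in [N], [m] is
    [O(log N)], so the double exponential in [o(m)] is [2 ^ o(N)]; in
    particular no sparsification of the 3CNF formula is needed. *)

From Stdlib Require Import FunctionalExtensionality Classical.
From mathcomp Require Import all_boot zify.
Require Import Defs.

Set Implicit Arguments.
Unset Strict Implicit.
Unset Printing Implicit Defensive.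

(** * MUS membership in terms of satisfiability *)

Lemma sat_subset n (S S' : cnf n) : S \subset S' -> sat S' -> sat S.
Proof.
move=> /subsetP sub /existsP[a /'forall_implyP sa].
by apply/existsP; exists a; apply/'forall_implyP => c /sub /sa.
Qed.

(** Any minimal unsatisfiable subset of [S] is a MUS, and it contains [C], since otherwise it would
    lie in the satisfiable set [S :\ C]. This trades minimality for two satisfiability
    conditions. *)
Lemma in_some_MUSP n (phi : cnf n) (C : clause n) :
  in_some_MUS phi C <->
  exists S : cnf n, [/\ S \subset phi, C \in S, ~~ sat S & sat (S :\ C)].
Proof.
split=> [[M [sub unsat minM] CM]|[S [sub CS unsat satS]]].
  by exists M; split=> //; apply: minM; apply: properD1.
have [M /minsetP[unsatM minM] MS] :=
  @minset_exists _ (fun D : cnf n => ~~ sat D) S unsat.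
exists M.
  split=> //; first exact: subset_trans sub.
  move=> D DM; apply: contraT => unsatD.
  by have DE := minM D unsatD (proper_sub DM); rewrite DE properxx in DM.
apply: contraT => CM; have: sat M; last by rewrite (negPf unsatM).
by apply: sat_subset satS; rewrite subsetD1 MS.
Qed.

(** * Untyped clauses and their codes *)

(* Clauses over an unbounded supply of variables: the program fixes the number
   of variables of its output only after having produced part of it. *)
Definition ulit : Type := (nat * bool)%type.

Definition usat (al : nat -> bool) (u : seq ulit) : bool :=
  has (fun l => al l.1 == l.2) u.

Definition ulit_of n (l : lit n) : ulit := (val l.1, l.2).

(** Literals with variables from [n] on are silently dropped, hence the hypotheses [bounded n]
    below. *)
Definition clause_of n (u : seq ulit) : clause n :=
  [set l : lit n | ulit_of l \in u].

Definition cnf_of n (us : seq (seq ulit)) : cnf n :=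
  [set c | c \in map (clause_of n) us].

Definition bounded n (u : seq ulit) : bool := all (fun l => l.1 < n) u.

Lemma ulit_of_inj n : injective (@ulit_of n).
Proof. by move=> [i b] [j c] [/val_inj-> ->]. Qed.

Lemma ulit_ofP n (l : ulit) : l.1 < n -> exists l' : lit n, ulit_of l' = l.
Proof. by case: l => i b /= lt_in; exists (Ordinal lt_in, b). Qed.

Lemma usat_clause_of n (a : {ffun 'I_n -> bool}) (al : nat -> bool) u :
  bounded n u -> (forall i : 'I_n, a i = al i) ->
  sat_clause a (clause_of n u) = usat al u.
Proof.
move=> /allP bu aE; apply/exists_inP/hasP => [[l]|[l lu al_l]].
  by rewrite inE aE => lu al_l; exists (ulit_of l).
have [l' lE] := ulit_ofP (bu l lu).
by exists l'; rewrite ?inE ?lE // aE; rewrite -lE in al_l.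
Qed.

Lemma clause_of_eq n u u' : bounded n u -> bounded n u' ->
  clause_of n u = clause_of n u' -> u =i u'.
Proof.
move=> /allP bu /allP bu' /setP eq_uu' l.
have [lt_ln|ge_ln] := ltnP l.1 n.
  by have [l' <-] := ulit_ofP lt_ln; have := eq_uu' l'; rewrite !inE.
by apply/idP/idP => [/bu|/bu']; rewrite ltnNge ge_ln.
Qed.

Lemma bounded_typed n u : bounded n u ->
  exists c : seq (lit n), map (@ulit_of n) c = u.
Proof.
elim: u => [|l u IHu] /= => [_|/andP[/ulit_ofP[l' <-] /IHu[c <-]]].
  by exists [::].
by exists (l' :: c).
Qed.

Definition code_ulit (l : ulit) : tree := Cons (code_bool l.2) (code_nat l.1).

Definition code_uclause (u : seq ulit) : tree := code_seq (map code_ulit u).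

Definition code_ucnf (us : seq (seq ulit)) : tree :=
  code_seq (map code_uclause us).

Lemma set_of_typed n (c : seq (lit n)) :
  [set l in c] = clause_of n (map (@ulit_of n) c).
Proof. by apply/setP=> l; rewrite !inE mem_map //; apply: ulit_of_inj. Qed.

Lemma code_typed n (c : seq (lit n)) :
  code_clause c = code_uclause (map (@ulit_of n) c).
Proof. by rewrite /code_uclause -map_comp. Qed.

Lemma clause_code n u : bounded n u -> uniq u ->
  is_clause_code (clause_of n u) (code_uclause u).
Proof.
move=> /bounded_typed[c <-] uniq_c; exists c; last by rewrite code_typed.
apply: uniq_perm; rewrite ?enum_uniq ?(map_uniq uniq_c) // => l.
by rewrite -set_of_typed mem_enum inE.
Qed.

(** Codes list sets without repetition, so the literals within a clause must be distinct, and so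
    must the clauses when compared as sets. *)
Lemma cnf_code n us : all (bounded n) us -> all uniq us ->
  uniq (map (clause_of n) us) ->
  is_cnf_code (cnf_of n us) (code_ucnf us).
Proof.
move=> b_us u_us uniq_us.
have [s sE]: exists s : seq (seq (lit n)), map (map (@ulit_of n)) s = us.
  elim: us b_us {u_us uniq_us} => [|u us IHus] /=; first by exists [::].
  by case/andP=> /bounded_typed[c <-] /IHus[s <-]; exists (c :: s).
exists s; split.
- apply/allP=> c cs; apply: (@map_uniq _ _ (@ulit_of n)).
  by apply: (allP u_us); rewrite -sE map_f.
- have -> : [seq [set l in c] | c <- s] = map (clause_of n) us.
    by rewrite -sE -map_comp; apply: eq_map => c /=; rewrite set_of_typed.
  by apply: uniq_perm; rewrite ?enum_uniq // => c; rewrite mem_enum inE.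
- rewrite /code_ucnf -sE -map_comp; congr code_seq.
  by apply: eq_map => c /=; rewrite code_typed.
Qed.

Lemma sat_cnf_of n us : all (bounded n) us ->
  reflect (exists al, forall u, u \in us -> usat al u) (sat (cnf_of n us)).
Proof.
move=> /allP b_us; apply: (iffP existsP) => -[al].
  move=> /'forall_implyP sal; pose al' i := oapp al false (insub i).
  exists al' => u u_us; rewrite -(@usat_clause_of n al) ?b_us //.
    by apply: sal; rewrite inE map_f.
  by move=> i; rewrite /al' valK.
move=> sal; exists [ffun i => al (val i)]; apply/'forall_implyP=> c.
rewrite inE => /mapP[u u_us ->].
by rewrite (@usat_clause_of _ _ al) ?b_us ?sal // => i; rewrite ffunE.
Qed.

(** * The formula *)

Lemma usat_cat al u u' : usat al (u ++ u') = usat al u || usat al u'.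
Proof. exact: has_cat. Qed.

(** The accumulator mirrors the loop [extend_cmd], so that the words come in the order in which the
    program produces them. *)
Definition extend (ws : seq (seq bool)) : seq (seq bool) :=
  foldl (fun acc w => (true :: w) :: (false :: w) :: acc) [::] ws.

Definition words (m : nat) : seq (seq bool) := iter m extend [:: [::]].

Lemma perm_extend ws :
  perm_eq (extend ws) (map (cons true) ws ++ map (cons false) ws).
Proof.
rewrite /extend -[X in perm_eq _ X]cats0; move: [::] => acc.
elim: ws acc => [|w ws IHws] acc //=; apply: perm_trans (IHws _) _.
by apply/permP => p; rewrite /= !count_cat /= ?count_cat /=; lia.
Qed.

Lemma words_mem m w : (w \in words m) = (size w == m).
Proof.
elim: m w => [|m IHm] [|x w] //=.
  by rewrite (perm_mem (perm_extend _)) mem_cat; apply/norP; split; apply/mapP => -[].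
rewrite (perm_mem (perm_extend _)) mem_cat eqSS -IHm.
have consF b : ((x :: w) \in map (cons b) (words m)) = (x == b) && (w \in words m).
  apply/mapP/andP => [[w' ww' [xb ww]]|[/eqP-> ww]]; last by exists w.
  by rewrite xb ww.
by rewrite !consF; case: (x); rewrite /= ?orbF.
Qed.

Lemma words_uniq m : uniq (words m).
Proof.
elim: m => // m IHm; rewrite [words _]/(extend (words m)).
rewrite (perm_uniq (perm_extend _)) cat_uniq.
have consI b : injective (@cons bool b) by move=> ? ? [].
rewrite !map_inj_uniq ?IHm ?andbT //=.
by apply/hasPn => _ /mapP[w _ ->]; apply/mapP => -[].
Qed.

Lemma size_words m : size (words m) = 2 ^ m.
Proof.
elim: m => // m IHm; rewrite [words _]/(extend (words m)).
rewrite (perm_size (perm_extend _)) size_cat !size_map.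
by rewrite IHm expnS mul2n addnn.
Qed.

(* With variable [N] true, [cell N w] is falsified by exactly one assignment
   of the variables [N + 1], ..., [N + size w]. *)
Fixpoint cell (N : nat) (w : seq bool) : seq ulit :=
  if w is b :: w' then (N.+1 + size w', b) :: cell N w' else [:: (N, false)].

(** If [al N] holds, this is the one word of length [m] whose cell [al] falsifies. The bits are
    negated because a literal [(i, b)] fails when [al i] is [~~ b]. *)
Fixpoint cell_word (N : nat) (al : nat -> bool) (m : nat) : seq bool :=
  if m is m'.+1 then ~~ al (N.+1 + m') :: cell_word N al m' else [::].

Lemma size_cell_word N al m : size (cell_word N al m) = m.
Proof. by elim: m => //= m ->. Qed.

Lemma cell_zN N w : (N, false) \in cell N w.
Proof. by elim: w => [|b w IHw]; rewrite ?mem_head // inE IHw orbT. Qed.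

Lemma cell_ge N w l : l \in cell N w -> N <= l.1 <= N + size w.
Proof.
elim: w => [|b w IHw] /=; first by rewrite inE => /eqP->; rewrite /= addn0 leqnn.
by rewrite inE => /orP[/eqP->|/IHw] /=; lia.
Qed.

Lemma cell_lt N w l : l.1 < N -> (l \in cell N w) = false.
Proof. by move=> lt_lN; apply/negP => /cell_ge; rewrite leqNgt lt_lN. Qed.

Lemma cell_var N w t : t < size w -> exists b, (N.+1 + t, b) \in cell N w.
Proof.
elim: w => [|b w IHw] //=; rewrite ltnS leq_eqVlt => /orP[/eqP->|/IHw[c cw]].
  by exists b; rewrite mem_head.
by exists c; rewrite inE cw orbT.
Qed.

Lemma cell_uniq N w : uniq (cell N w).
Proof.
elim: w => [|b w IHw] //=; rewrite IHw andbT.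
by apply/negP => /cell_ge /=; lia.
Qed.

Lemma usat_cell N (al : nat -> bool) w : al N ->
  usat al (cell N w) = (w != cell_word N al (size w)).
Proof.
move=> alN; elim: w => [|b w IHw]; first by rewrite /= alN.
rewrite [usat _ _]/((al (N.+1 + size w) == b) || usat al (cell N w)) IHw /=.
by rewrite eqseq_cons negb_and; case: b; case: (al _).
Qed.

Lemma cell_consistent N w i b :
  (i, b) \in cell N w -> ((i, false) \in cell N w) = ~~ b.
Proof.
elim: w => [|x w IHw] /=; first by rewrite !inE => /eqP[-> ->]; rewrite eqxx.
rewrite !inE => /orP[/eqP[-> ->]|iw]; rewrite xpair_eqE.
  rewrite eqxx; case: x => //=; apply/negP => /cell_ge /=; lia.
by rewrite IHw //; have /= := cell_ge iw; case: eqP => //=; lia.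
Qed.

(** Prolongs [be] from the variables below [N] to an assignment that falsifies [cell N w]: from [N]
    on, a variable is true iff it occurs negatively in the cell. *)
Definition falsifier (w : seq bool) (N : nat) (be : nat -> bool) (i : nat) :=
  if i < N then be i else (i, false) \in cell N w.

Lemma falsifierN w N be : falsifier w N be N.
Proof. by rewrite /falsifier ltnn cell_zN. Qed.

Lemma cell_word_falsifier w N be : cell_word N (falsifier w N be) (size w) = w.
Proof.
apply/esym/eqP; apply: negbNE; rewrite -usat_cell ?falsifierN //.
apply/hasPn => -[i b] /= iw; have /andP[/= ge_i _] := cell_ge iw.
by rewrite /falsifier ltnNge ge_i (cell_consistent iw); case: b {iw}.
Qed.

(** An assignment that falsifies the larger cell also falsifies the smaller one, and with [N] true
    it falsifies only one cell of each length. *)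
Lemma cell_sub_inj N w w' : size w = size w' ->
  {subset cell N w <= cell N w'} -> w = w'.
Proof.
move=> eq_size sub; pose al := falsifier w' N xpredT.
rewrite -(cell_word_falsifier w' N xpredT) -eq_size.
apply/eqP/negbNE; rewrite -usat_cell ?falsifierN //.
have: ~~ usat al (cell N w').
  by rewrite /al usat_cell ?falsifierN // cell_word_falsifier eqxx.
by apply: contra => /hasP[l /sub lw al_l]; apply/hasP; exists l.
Qed.

Lemma cell_inj N : injective (cell N).
Proof.
have size_cell w : size (cell N w) = (size w).+1 by elim: w => //= b w ->.
move=> w w' eq_w; apply: (@cell_sub_inj N); last by rewrite eq_w.
by apply: succn_inj; rewrite -!size_cell eq_w.
Qed.

Definition unit_clauses (N : nat) : seq (seq ulit) :=
  [seq [:: (i, b)] | i <- iota 0 N, b <- [:: true; false]].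

(* The [j]-th clause of [cls] is attached to the [j]-th word of [ws]; the
   words of [ws'] are attached to no clause. *)
Definition mus_clauses (N : nat) (cls : seq (seq ulit))
    (ws ws' : seq (seq bool)) : seq (seq ulit) :=
  catrev (map (cell N) ws')
    (catrev [seq l :: cell N p.2 | p <- zip cls ws, l <- p.1]
       (unit_clauses N ++ [:: [:: (N, true)]])).

Lemma mem_unit_clauses N u :
  reflect (exists i b, i < N /\ u = [:: (i, b)]) (u \in unit_clauses N).
Proof.
apply: (iffP allpairsP) => [[[i b] /= [iN _ ->]]|[i [b [iN ->]]]].
  by exists i, b; rewrite mem_iota in iN.
by exists (i, b); rewrite mem_iota !inE; case: b.
Qed.

(** Forgets the order of the clauses, which is fixed only to match the output of the program. *)
Variant mus_clause_spec (N : nat) (cls : seq (seq ulit))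
    (ws ws' : seq (seq bool)) : seq ulit -> Prop :=
  | MusGoal : mus_clause_spec N cls ws ws' [:: (N, true)]
  | MusUnit i b of i < N : mus_clause_spec N cls ws ws' [:: (i, b)]
  | MusCheck c w l of (c, w) \in zip cls ws & l \in c :
      mus_clause_spec N cls ws ws' (l :: cell N w)
  | MusExcess w of w \in ws' : mus_clause_spec N cls ws ws' (cell N w).

Lemma mem_mus_clauses N cls ws ws' u :
  u \in mus_clauses N cls ws ws' <-> mus_clause_spec N cls ws ws' u.
Proof.
rewrite /mus_clauses !catrevE !mem_cat !mem_rev inE; split.
  case/or4P => [/mapP[w ww ->]|/allpairsPdep[[c w] [l [cw lc ->]]]|
    /mem_unit_clauses[i [b [iN ->]]]|/eqP->]; by econstructor; eauto.
case=> [|i b iN|c w l cw lc|w ww].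
- by rewrite eqxx !orbT.
- by apply/or4P/Or43/mem_unit_clauses; exists i, b.
- by apply/or4P/Or42/allpairsPdep; exists (c, w), l.
- by apply/or4P/Or41/map_f.
Qed.
(** An excess word provides a clause containing all variables from [N] on, so that these occur even
    if there is no check clause. *)
Definition assigned N m (cls : seq (seq ulit)) (ws ws' : seq (seq bool)) : Prop :=
  [/\ all (bounded N) cls, all uniq cls, size ws = size cls,
      ws ++ ws' = words m & ws' != [::]].

Lemma assigned_size N m cls ws ws' w : assigned N m cls ws ws' ->
  w \in ws ++ ws' -> size w = m.
Proof. by case=> _ _ _ -> _; rewrite words_mem => /eqP. Qed.

Lemma assigned_zip N m cls ws ws' c w : assigned N m cls ws ws' ->
  (c, w) \in zip cls ws -> [/\ c \in cls, w \in ws & size w = m].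
Proof.
move=> as_m cw; have [_ _ eq_size _ _] := as_m.
have wws : w \in ws.
  by rewrite -(@unzip2_zip _ _ cls ws) ?eq_size // (map_f snd cw).
split=> //; last by apply: assigned_size as_m _; rewrite mem_cat wws.
by rewrite -(@unzip1_zip _ _ cls ws) ?eq_size // (map_f fst cw).
Qed.

Lemma assigned_lt N m cls ws ws' c w l : assigned N m cls ws ws' ->
  (c, w) \in zip cls ws -> l \in c -> l.1 < N.
Proof.
move=> as_m cw lc; have [ccls _ _] := assigned_zip as_m cw.
by have [b_cls _ _ _ _] := as_m; apply: (allP (allP b_cls _ ccls)).
Qed.

(** Repetitions in [cls] do no harm: the words are distinct, so a word fixes its position in
    [ws]. *)
Lemma assigned_inj N m cls ws ws' c c' w : assigned N m cls ws ws' ->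
  (c, w) \in zip cls ws -> (c', w) \in zip cls ws -> c = c'.
Proof.
case=> _ _ eq_size wsE _ cw cw'.
have: uniq ws by have := words_uniq m; rewrite -wsE cat_uniq => /andP[].
rewrite -(@unzip2_zip _ _ cls ws) ?eq_size // => uniq_ws.
have [i lt_i iE] := (nthP ([::], [::]) cw); have [j lt_j jE] := (nthP ([::], [::]) cw').
suff ij: i = j by move: iE; rewrite ij jE => -[].
apply/eqP; rewrite -(nth_uniq [::] _ _ uniq_ws) ?size_map //.
by rewrite !(nth_map ([::], [::])) // iE jE.
Qed.

Lemma assigned_disjoint N m cls ws ws' w : assigned N m cls ws ws' ->
  w \in ws -> w \in ws' -> False.
Proof.
case=> _ _ _ wsE _ ww ww'; have := words_uniq m.
by rewrite -wsE cat_uniq => /and3P[_ /hasP[]]; exists w.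
Qed.

(** * Well-formedness of the clause list *)

Lemma mus_clauses_bounded N m cls ws ws' : assigned N m cls ws ws' ->
  all (bounded (N + m.+1)) (mus_clauses N cls ws ws').
Proof.
move=> as_m; have [b_cls _ _ _ _] := as_m; apply/allP=> u.
have b_cell w : size w = m -> bounded (N + m.+1) (cell N w).
  by move=> <-; apply/allP=> l /cell_ge /=; lia.
case/mem_mus_clauses => [|i b lt_iN|c w l cw lc|w ww'].
- by rewrite /bounded /= andbT; lia.
- by rewrite /bounded /= andbT; lia.
- have [ccls _ sw] := assigned_zip as_m cw.
  rewrite /bounded /= [all _ _]b_cell // andbT.
  by have := allP (allP b_cls _ ccls) _ lc; lia.
- by apply/b_cell/(assigned_size as_m); rewrite mem_cat ww' orbT.
Qed.

Lemma mus_clauses_all_uniq N m cls ws ws' : assigned N m cls ws ws' ->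
  all uniq (mus_clauses N cls ws ws').
Proof.
move=> as_m; have [b_cls _ _ _ _] := as_m; apply/allP=> u.
case/mem_mus_clauses => [|i b lt_iN|c w l cw lc|w ww'] //=; rewrite cell_uniq //.
rewrite andbT; have [ccls _ sw] := assigned_zip as_m cw.
by rewrite cell_lt ?(allP (allP b_cls _ ccls) _ lc).
Qed.

(** A formula is a set of sets, so a clause has to be recovered from its literals alone. Every cell
    contains [(N, false)], and a check clause has in addition exactly one literal below [N]. *)
Lemma mus_clauses_eq N m cls ws ws' u u' : assigned N m cls ws ws' ->
  u \in mus_clauses N cls ws ws' -> u' \in mus_clauses N cls ws ws' ->
  u =i u' -> u = u'.
Proof.
move=> as_m.
have lt_check c w l : (c, w) \in zip cls ws -> l \in c -> l.1 < N.
  exact: assigned_lt as_m.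
have size_zip c w : (c, w) \in zip cls ws -> size w = m.
  by move=> cw; have [] := assigned_zip as_m cw.
have size_ws w : w \in ws' -> size w = m.
  by move=> ww; apply/(assigned_size as_m); rewrite mem_cat ww orbT.
have unit_cell i b w : i <= N -> [:: (i, b)] =i cell N w -> [:: (i, b)] = cell N w.
  move=> le_iN eq_i; have := eq_i (N, false); rewrite cell_zN inE => /eqP[<- <-].
  case: w eq_i => [|x w] //= eq_i; have := eq_i (N.+1 + size w, x).
  by rewrite mem_head inE => /eqP[iE _]; move: le_iN; rewrite -iE; lia.
have cell_check w c w' l : size w = m -> (c, w') \in zip cls ws -> l \in c ->
  cell N w =i l :: cell N w' -> False.
  move=> sw cw lc eq_w; have := eq_w l; by rewrite mem_head cell_lt ?(lt_check _ _ _ cw lc).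
have unit_check i b c w l : (c, w) \in zip cls ws -> l \in c ->
  [:: (i, b)] =i l :: cell N w -> False.
  move=> cw lc eq_i; have := eq_i l; rewrite mem_head inE => /eqP lE.
  have := eq_i (N, false); rewrite !inE cell_zN orbT => /eqP zE.
  by have := lt_check _ _ _ cw lc; rewrite lE -zE ltnn.
have eq_sym (v v' : seq ulit) : v =i v' -> v' =i v by move=> vv' l; rewrite vv'.
case/mem_mus_clauses => [|i b lt_iN|c w l cw lc|w ww];
  case/mem_mus_clauses => [|i' b' lt_iN'|c' w' l' cw' lc'|w' ww'] // eq_uu'.
- by have := eq_uu' (N, true); rewrite mem_head inE => /esym/eqP->.
- by case: (unit_check _ _ _ _ _ cw' lc' eq_uu').
- exact: unit_cell.
- by have := eq_uu' (N, true); rewrite mem_head inE => /eqP->.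
- by have := eq_uu' (i, b); rewrite mem_head inE => /esym/eqP->.
- by case: (unit_check _ _ _ _ _ cw' lc' eq_uu').
- by apply: unit_cell => //; apply: ltnW.
- by case: (unit_check _ _ _ _ _ cw lc (eq_sym _ _ eq_uu')).
- by case: (unit_check _ _ _ _ _ cw lc (eq_sym _ _ eq_uu')).
- have ww' : w = w'.
    apply: (@cell_sub_inj N); first by rewrite (size_zip _ _ cw) (size_zip _ _ cw').
    move=> v vw; have := eq_uu' v; rewrite !inE vw orbT => /esym/orP[/eqP vE|//].
    by rewrite vE cell_lt ?(lt_check _ _ _ cw' lc') in vw.
  rewrite -ww' in eq_uu' *; congr (_ :: _).
  have := eq_uu' l; rewrite mem_head inE cell_lt ?(lt_check _ _ _ cw lc) // orbF.
  by move=> /esym/eqP.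
- by case: (cell_check w' _ _ _ (size_ws _ ww') cw lc (eq_sym _ _ eq_uu')).
- by apply/esym/unit_cell => //; apply: eq_sym.
- by apply/esym/unit_cell; [apply: ltnW | apply: eq_sym].
- by case: (cell_check w _ _ _ (size_ws _ ww) cw' lc' eq_uu').
- congr (cell N _).
  by apply: (@cell_sub_inj N); rewrite ?size_ws // => v; rewrite eq_uu'.
Qed.

Lemma mus_clauses_uniq N m cls ws ws' : assigned N m cls ws ws' ->
  uniq (map (clause_of (N + m.+1)) (mus_clauses N cls ws ws')).
Proof.
move=> as_m; have [b_cls u_cls eq_size wsE _] := as_m.
have b_out := allP (mus_clauses_bounded as_m).
rewrite map_inj_in_uniq; last first.
  move=> u u' u_out u'_out /clause_of_eq eq_uu'.
  by apply: (mus_clauses_eq as_m) => //; apply: eq_uu'; apply: b_out.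
have: uniq (ws ++ ws') by rewrite wsE words_uniq.
rewrite cat_uniq => /and3P[uniq_ws _ uniq_ws'].
rewrite /mus_clauses !catrevE !cat_uniq !rev_uniq map_inj_uniq ?uniq_ws' //=;
  last exact: cell_inj.
apply/and5P; split.
(* An excess cell has no variable below [N], whereas check and unit clauses begin with one; and it
   contains [(N, false)], unlike the goal. *)
- apply/hasPn => u; rewrite !mem_cat mem_rev => u_in; rewrite mem_rev.
  apply/mapP => -[w ww uE]; move: u_in; rewrite uE => {u uE}.
  case/or3P => [/allpairsPdep[[c w'] [l [cw lc eq_w]]]|
    /mem_unit_clauses[i [b [iN eq_w]]]|].
  + have := mem_head l (cell N w'); rewrite -eq_w cell_lt //.
    exact: assigned_lt as_m cw lc.
  + by have := mem_head (i, b) [::]; rewrite -eq_w cell_lt.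
  + by rewrite inE => /eqP eq_w; have := cell_zN N w; rewrite eq_w inE xpair_eqE andbF.
(* Head and tail of a check clause determine its literal and its word, and the word determines the
   clause of [cls]. *)
- apply: (@allpairs_uniq_dep (seq ulit * seq bool)%type (fun=> ulit) (seq ulit)
    (fun p l => l :: cell N p.2)).
  + by apply: (@map_uniq _ _ snd); rewrite -/(unzip2 _) unzip2_zip ?eq_size.
  + by move=> [c w] /(assigned_zip as_m)[ccls _ _]; apply: (allP u_cls).
  + move=> x y /allpairsPdep[[c w] [l [cw lc ->]]].
    move=> /allpairsPdep[[c' w'] [l' [cw' lc' ->]]] /= [eq_l /cell_inj eq_w].
    rewrite -{}eq_l -{}eq_w in cw' lc' *.
    by rewrite (assigned_inj as_m cw cw').
(* A check clause has at least two literals. *)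
- apply/hasPn => u; rewrite mem_cat => u_in; rewrite mem_rev.
  apply/negP => /allpairsPdep[[c w'] [l [cw lc uE]]]; move: u_in; rewrite {}uE.
  have szE : size (l :: cell N w') != 1 by case: (w').
  rewrite inE => /orP[/mem_unit_clauses[i [b [iN eq_w]]]|/eqP eq_w];
    by rewrite eq_w in szE.
- apply: allpairs_uniq; rewrite ?iota_uniq //.
  by move=> [i b] [j c] _ _ /= [-> ->].
- rewrite /= orbF andbT; apply/negP => /mem_unit_clauses[i [b [iN [NE _]]]].
  by rewrite NE ltnn in iN.
Qed.

Lemma mus_clauses_vars N m cls ws ws' : assigned N m cls ws ws' ->
  all_vars_occur (cnf_of (N + m.+1) (mus_clauses N cls ws ws')).
Proof.
move=> as_m; have [_ _ _ _ ws'_n0] := as_m.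
have occurs u (l : lit (N + m.+1)) : u \in mus_clauses N cls ws ws' ->
    ulit_of l \in u -> l.1 \in cnf_vars (cnf_of (N + m.+1) (mus_clauses N cls ws ws')).
  move=> u_out lu; apply/bigcupP; exists (clause_of _ u); first by rewrite inE map_f.
  by apply/imsetP; exists l; rewrite ?inE.
apply/setP => v; rewrite [RHS]inE; have [lt_vN|ge_vN] := ltnP v N.
  apply: (occurs [:: (val v, true)] (v, true)); last exact: mem_head.
  by apply/mem_mus_clauses; apply: MusUnit.
case: ws' as_m ws'_n0 occurs => //= w ws' as_m _ occurs.
have sw : size w = m by apply: assigned_size as_m _; rewrite mem_cat mem_head orbT.
have w_out : cell N w \in mus_clauses N cls ws (w :: ws').
  by apply/mem_mus_clauses/MusExcess/mem_head.
have [b vb] : exists b, (val v, b) \in cell N w.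
  have [vN|lt_Nv] := eqVneq (val v) N; first by exists false; rewrite vN cell_zN.
  have [|b vb] := @cell_var N w (v - N.+1).
    by have := ltn_ord v; rewrite sw; move: lt_Nv => /=; lia.
  by exists b; rewrite subnKC // in vb; rewrite ltn_neqAle eq_sym lt_Nv.
exact: (occurs _ (v, b) w_out vb).
Qed.

(** * Equivalence with satisfiability of the 3CNF formula *)

Lemma sat_sub n us (S : cnf n) : all (bounded n) us -> S \subset cnf_of n us ->
  reflect (exists al, forall u, u \in us -> clause_of n u \in S -> usat al u) (sat S).
Proof.
move=> b_us /subsetP sub; pose us' := [seq u <- us | clause_of n u \in S].
have SE : S = cnf_of n us'.
  apply/setP=> c; rewrite inE; apply/idP/mapP => [cS|[u u_us' ->]].
    have := sub c cS; rewrite inE => /mapP[u u_us cE].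
    by exists u; rewrite // mem_filter -cE cS.
  by move: u_us'; rewrite mem_filter => /andP[].
have b_us' : all (bounded n) us'.
  by apply/allP=> u; rewrite mem_filter => /andP[_ /(allP b_us)].
rewrite {2}SE; apply: (iffP (sat_cnf_of b_us')) => -[al sal]; exists al => u.
  by move=> u_us uS; apply: sal; rewrite mem_filter uS.
by rewrite mem_filter => /andP[uS u_us]; apply: sal.
Qed.

Lemma mus_clauses_correct N m cls ws ws' : assigned N m cls ws ws' ->
  in_some_MUS (cnf_of (N + m.+1) (mus_clauses N cls ws ws'))
              (clause_of (N + m.+1) [:: (N, true)]) <->
  exists al, forall c, c \in cls -> usat al c.
Proof.
move=> as_m; have [_ _ eq_size wsE _] := as_m.
set n := N + m.+1; set out := mus_clauses N cls ws ws'; set C := clause_of n _.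
have b_out : all (bounded n) out := mus_clauses_bounded as_m.
have lt_cls c w l : (c, w) \in zip cls ws -> l \in c -> l.1 < N.
  exact: assigned_lt as_m.
have goal_out : [:: (N, true)] \in out by apply/mem_mus_clauses/MusGoal.
have unit_out i b : i < N -> [:: (i, b)] \in out.
  by move=> iN; apply/mem_mus_clauses/MusUnit.
have check_out c w l : (c, w) \in zip cls ws -> l \in c -> l :: cell N w \in out.
  by move=> cw lc; apply/mem_mus_clauses; apply: MusCheck lc.
have excess_out w : w \in ws' -> cell N w \in out.
  by move=> ww; apply/mem_mus_clauses/MusExcess.
split=> [/in_some_MUSP[S [sub CS unsat /(sat_sub b_out)]]|[al0 sal0]].
  case=> [|al1 sal1]; first by apply: subset_trans sub; apply: subD1set.
  (* If the complement of [al1] failed on [c], then [al1] would satisfy every literal of [c]; making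
     [z] true and letting the [y_t] falsify the cell of [c] would then satisfy [S]. *)
  exists (fun i => ~~ al1 i) => c ccls; apply: contraT => unsat_c.
  have [w cw] : exists w, (c, w) \in zip cls ws.
    rewrite -(@unzip1_zip _ _ cls ws) ?eq_size // in ccls.
    by have [[c' w] cw ->] := mapP ccls; exists w.
  have [_ ww sw] := assigned_zip as_m cw.
  case/negP: unsat; apply/(sat_sub b_out sub); pose al := falsifier w N al1.
  have alN : al N by apply: falsifierN.
  have alE i : i < N -> al i = al1 i by rewrite /al /falsifier => ->.
  have cell_sat w' : size w' = m -> w' != w -> usat al (cell N w').
    by move=> sw' neq_w; rewrite usat_cell // sw' -sw cell_word_falsifier.
  exists al => u; case/mem_mus_clauses => [|i b lt_iN|c' w' l cw' lc|w' ww'] uS.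
  - by rewrite /= alN.
  (* [al1] satisfies the unit clauses of [S], since they differ from the removed goal. *)
  - rewrite /= alE // -[_ || _]/(usat al1 [:: (i, b)]); apply: sal1; first exact: unit_out.
    rewrite !inE uS andbT; apply/eqP => /clause_of_eq eq_C.
    have /eq_C eq_i : bounded n [:: (i, b)] by apply: (allP b_out); apply: unit_out.
    have := eq_i (allP b_out _ goal_out) (i, b); rewrite mem_head inE => /esym/eqP[iE _].
    by rewrite iE ltnn in lt_iN.
  - have [_ _ sw'] := assigned_zip as_m cw'.
    have [w'E|neq_w] := eqVneq w' w; last first.
      by rewrite -cat1s usat_cat cell_sat ?orbT.
    rewrite w'E in cw' *; have cE := assigned_inj as_m cw' cw.
    rewrite cE in cw' lc.
    have := hasPn unsat_c l lc; rewrite /= alE ?(lt_cls _ _ _ cw' lc) //.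
    by case: (al1 _); case: (l.2).
  - apply: cell_sat; first by apply: (assigned_size as_m); rewrite mem_cat ww' orbT.
    by apply/eqP => ww'E; apply: (assigned_disjoint as_m ww); rewrite -ww'E.
(* Of the unit clauses, those forcing the complement of [al0] are kept. The condition [N <= i] keeps
   the goal and, when [m] is 0, the one-literal cell. *)
pose P (u : seq ulit) := if u is [:: (i, b)] then (N <= i) || (b != al0 i) else true.
apply/in_some_MUSP; exists (cnf_of n (filter P out)).
have sub : cnf_of n (filter P out) \subset cnf_of n out.
  apply/subsetP=> c; rewrite !inE => /mapP[u]; rewrite mem_filter => /andP[_ u_out ->].
  exact: map_f.
have b_Pout : all (bounded n) (filter P out).
  by apply/allP=> u; rewrite mem_filter => /andP[_ /(allP b_out)].
split=> //.
- by rewrite inE map_f // mem_filter goal_out /= leqnn.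
- apply/(sat_cnf_of b_Pout) => -[al sal].
  have alN : al N.
    by have := sal [:: (N, true)]; rewrite mem_filter goal_out /= leqnn /= orbF => /(_ isT)/eqP.
  have alE i : i < N -> al i = ~~ al0 i.
    move=> iN; have := sal [:: (i, ~~ al0 i)]; rewrite mem_filter unit_out // andbT /= orbF.
    by case: (al0 i); rewrite orbT => /(_ isT)/eqP.
  (* The word whose cell [al] falsifies is either excess or attached to some [c]; in the latter case
     a literal of [c] true under [al0] is false under [al]. Either way a kept clause fails. *)
  have: cell_word N al m \in ws ++ ws' by rewrite wsE words_mem size_cell_word.
  have unsat_cell : ~~ usat al (cell N (cell_word N al m)).
    by rewrite usat_cell // size_cell_word eqxx.
  rewrite mem_cat => /orP[ww|ww].
    rewrite -(@unzip2_zip _ _ cls ws) ?eq_size // in ww.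
    have [[c w] cw /= wE] := mapP ww; rewrite wE in unsat_cell.
    have [ccls _ _] := assigned_zip as_m cw.
    have [l lc al0_l] := hasP (sal0 c ccls).
    have := sal (l :: cell N w); rewrite mem_filter (check_out c) // andbT.
    have -> : P (l :: cell N w) by case: (l) => ? ?; case: (w).
    move=> /(_ isT); rewrite -cat1s usat_cat (negPf unsat_cell) orbF /= orbF.
    by rewrite alE ?(lt_cls _ _ _ cw lc) // (eqP al0_l); case: (l.2).
  have := sal _ (_ : cell N (cell_word N al m) \in filter P out).
  rewrite (negPf unsat_cell) => /(_ _)/notF; apply; rewrite mem_filter excess_out // andbT.
  by case: (cell_word _ _ _) => [|? []] //=; rewrite leqnn.
- apply/(sat_sub b_out); first by apply: subset_trans sub; apply: subD1set.
  (* Without the goal, making [z] false satisfies every cell, and the kept unit clauses agree with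
     the complement of [al0]. *)
  exists (fun i => (i < N) && ~~ al0 i) => u u_out; rewrite !inE => /andP[uC].
  move=> /mapP[u']; rewrite mem_filter => /andP[Pu' u'_out] /clause_of_eq eq_uu'.
  have uE : u = u' by apply: (mus_clauses_eq as_m) => //; apply: eq_uu'; apply: (allP b_out).
  rewrite -{u' eq_uu'}uE in u'_out Pu'.
  case/mem_mus_clauses: u_out uC Pu' => [|i b lt_iN|c w l cw lc|w ww] /=.
  + by rewrite eqxx.
  + by move=> _; rewrite leqNgt lt_iN /=; case: b; case: (al0 i).
  + move=> _ _; apply/orP; right; apply/hasP; exists (N, false); rewrite ?cell_zN //=.
    by rewrite ltnn.
  + move=> _ _; apply/hasP; exists (N, false); rewrite ?cell_zN //=.
    by rewrite ltnn.
Qed.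

(** * Its treewidth *)

Definition star (T : finType) : rel (option T) :=
  fun x y => (x == None) != (y == None).
Arguments star : clear implicits.

(** A cycle would alternate between the centre and leaves, so one of length at least 3 would repeat
    a vertex. *)
Lemma star_tree (T : finType) : is_tree (star T).
Proof.
split.
- by rewrite card_option.
- by move=> x y; rewrite /star eq_sym.
- by move=> x; rewrite /star eqxx.
- have root x : connect (star T) x None by case: x => [x|]; rewrite ?connect0 ?connect1.
  have sym : connect_sym (star T) by apply: sym_connect_sym => x y; rewrite /star eq_sym.
  by move=> x y; apply: connect_trans (root x) _; rewrite sym.
- move=> [|x [|y [|z p]]] //= /andP[/= cyc uniq_p]; exfalso; move: cyc uniq_p.
  case: x => [x|]; case: y => [y|]; case: z => [z|]; rewrite /star //=.
  by case: p => [|[t|] p] //=; rewrite andbF.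
Qed.

Lemma mus_clauses_treewidth N m cls ws ws' : assigned N m cls ws ws' ->
  treewidth_le (primal_graph (cnf_of (N + m.+1) (mus_clauses N cls ws ws'))) m.+1.
Proof.
move=> as_m; set n := N + m.+1.
pose bag (x : option 'I_N) := [set v : 'I_n | (N <= v) || (Some (val v) == omap val x)].
have bag_Some (v : 'I_n) (lt_vN : v < N) : v \in bag (Some (Ordinal lt_vN)).
  by rewrite inE /= eqxx orbT.
exists (option 'I_N), (star _), bag; split; last first.
  have bagN : #|bag None| <= m.+1.
    rewrite -[X in _ <= X]card_ord -(card_imset predT (@rshift_inj N m.+1)).
    apply/subset_leq_card/subsetP => v; rewrite inE orbF => ge_vN.
    apply/imsetP; case: (split_ordP v) => j vE; last by exists j.
    by move: ge_vN; rewrite vE leqNgt /= ltn_ord.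
  move=> [i|]; last exact: leq_trans bagN _.
  have -> : bag (Some i) = lshift m.+1 i |: bag None.
    by apply/setP => v; rewrite !inE orbF orbC -val_eqE.
  by rewrite cardsU1; apply: leq_trans (leq_add (leq_b1 _) bagN) _.
split; first exact: star_tree.
- move=> v; have [lt_vN|ge_vN] := ltnP v N; last by exists None; rewrite inE ge_vN.
  by exists (Some (Ordinal lt_vN)).
- move=> v w /andP[neq_vw /exists_inP[c]]; rewrite inE => /mapP[u u_out ->].
  move=> /andP[/imsetP[l]]; rewrite inE => lu -> /imsetP[l']; rewrite inE => l'u ->.
  (* Each clause fits into a single bag: that of its variable below [N] if it has one, and the
     centre otherwise. *)
  have {neq_vw}: exists x : option 'I_N,
      forall l : lit n, ulit_of l \in u -> l.1 \in bag x.
    have cell_bag w' x (k : lit n) : ulit_of k \in cell N w' -> k.1 \in bag x.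
      by move=> /cell_ge/andP[ge_k _]; rewrite inE ge_k.
    case/mem_mus_clauses: u_out => [|i b lt_iN|c' w' k cw kc|w' ww'].
    + by exists None => k; rewrite !inE => /eqP[-> _]; rewrite leqnn.
    + exists (Some (Ordinal lt_iN)) => k; rewrite !inE => /eqP[kE _].
      by rewrite /= kE eqxx orbT.
    + have lt_kN := assigned_lt as_m cw kc.
      exists (Some (Ordinal lt_kN)) => k'.
      rewrite inE => /orP[/eqP kE|/cell_bag//].
      by rewrite inE /= -kE eqxx orbT.
    + by exists None => k /cell_bag.
  by case=> x bag_x; exists x; rewrite !bag_x.
(* A variable from [N] on is in every bag, so its bags form the whole star; a variable below [N] is
   in one bag only. *)
- move=> v x y; rewrite !inE; case: (leqP N v) => /= [ge_vN _ _|lt_vN].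
    have [_ _ _ connected _] := star_tree 'I_N.
    rewrite (@eq_connect _ _ (star 'I_N)) //.
    by move=> x' y' /=; rewrite !inE ge_vN !andbT.
  move: x y => [i|] [j|] //= /eqP[vi] /eqP[vj].
  by rewrite (_ : i = j) ?connect0 //; apply: val_inj; rewrite /= -vi -vj.
Qed.

(** * The program *)

Definition run (c : cmd) (s s' : store) (T : nat) : Prop :=
  exists2 r, exec c s s' r & r <= T.

Lemma run_le c s s' T T' : run c s s' T -> T <= T' -> run c s s' T'.
Proof. by case=> r cr le_rT le_TT'; exists r => //; apply: leq_trans le_TT'. Qed.

Lemma run_seq c d s s' s'' T T' :
  run c s s' T -> run d s' s'' T' -> run (Seq c d) s s'' (T + T').
Proof.
case=> r cr le_rT [r' dr' le_r'T']; exists (r + r').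
  exact: exec_seq cr dr'.
exact: leq_add.
Qed.

Lemma run_stop e c s : is_nil (eval s e) -> run (While e c) s s (expr_time e).+1.
Proof. by move=> nil_e; exists (expr_time e).+1; first exact: exec_while_stop. Qed.

Lemma run_step e c s s' s'' T T' : ~~ is_nil (eval s e) ->
  run c s s' T -> run (While e c) s' s'' T' ->
  run (While e c) s s'' ((expr_time e).+1 + T + T').
Proof.
move=> e_n0 [r cr le_rT] [r' er' le_r'T']; exists ((expr_time e).+1 + r + r').
  exact: exec_while_step cr er'.
by rewrite leq_add // leq_add2l.
Qed.

(** Stores presented as lists with default [Nil] let assignments be executed by computation. *)
Lemma update_nth (l : seq tree) x a :
  update (nth Nil l) x a = nth Nil (set_nth Nil l x a).
Proof.
by apply: functional_extensionality => y; rewrite /update nth_set_nth.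
Qed.

Lemma run_assign x e (l : seq tree) :
  run (Assign x e) (nth Nil l)
    (nth Nil (set_nth Nil l x (eval (nth Nil l) e))) (expr_time e).+1.
Proof. by exists (expr_time e).+1; rewrite -?update_nth //; apply: exec_assign. Qed.

(* The variables of the reduction: the input, the number [N] of variables of
   the input, the clauses and literals still to be read, two unary counters,
   the cells still to be used, the cells under construction, the clauses for
   which cells are still missing, the next fresh variable, and the output. *)
Definition state (inp N cls c k i cells cells' rest fresh out : tree) : store :=
  nth Nil [:: inp; N; cls; c; k; i; cells; cells'; rest; fresh; out].

Definition ETrue : expr := ECons ENil ENil.
Definition ESing (e : expr) : expr := ECons e ENil.

Definition subtract_cmd : cmd :=
  While (EVar 5) (Seq (Assign 4 (ETl (EVar 4))) (Assign 5 (ETl (EVar 5)))).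

Definition add_cmd : cmd :=
  While (EVar 4)
    (Seq (Assign 1 (ECons ENil (EVar 1))) (Assign 4 (ETl (EVar 4)))).

(* [max N (v + 1)] is computed as [N + (v + 1 - N)]. *)
Definition max_clause_cmd : cmd :=
  While (EVar 3)
    (Seq (Assign 4 (ECons ENil (ETl (EHd (EVar 3)))))
    (Seq (Assign 5 (EVar 1))
    (Seq subtract_cmd
    (Seq add_cmd
         (Assign 3 (ETl (EVar 3))))))).

Definition max_loop_cmd : cmd :=
  While (EVar 2)
    (Seq (Assign 3 (EHd (EVar 2)))
    (Seq max_clause_cmd
         (Assign 2 (ETl (EVar 2))))).

Definition units_loop_cmd : cmd :=
  While (EVar 5)
    (Seq (Assign 5 (ETl (EVar 5)))
         (Assign 10 (ECons (ESing (ECons ETrue (EVar 5)))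
                    (ECons (ESing (ECons ENil (EVar 5))) (EVar 10))))).

Definition extend_cmd : cmd :=
  While (EVar 6)
    (Seq (Assign 7 (ECons (ECons (ECons ETrue (EVar 9)) (EHd (EVar 6)))
                   (ECons (ECons (ECons ENil (EVar 9)) (EHd (EVar 6)))
                          (EVar 7))))
    (Seq (Assign 8 (ETl (EVar 8)))
         (Assign 6 (ETl (EVar 6))))).

(** The list in variable 8 starts as the input and serves as a counter: each old cell removes one
    entry, so [2 ^ r - 1] entries are gone after [r] rounds, and the loop stops once there are more
    cells than clauses. *)
Definition cells_loop_cmd : cmd :=
  While (EVar 8)
    (Seq extend_cmd
    (Seq (Assign 6 (EVar 7))
    (Seq (Assign 7 ENil)
         (Assign 9 (ECons ENil (EVar 9)))))).

Definition checks_clause_cmd : cmd :=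
  While (EVar 3)
    (Seq (Assign 10 (ECons (ECons (EHd (EVar 3)) (EHd (EVar 6))) (EVar 10)))
         (Assign 3 (ETl (EVar 3)))).

Definition checks_loop_cmd : cmd :=
  While (EVar 2)
    (Seq (Assign 3 (EHd (EVar 2)))
    (Seq checks_clause_cmd
    (Seq (Assign 6 (ETl (EVar 6)))
         (Assign 2 (ETl (EVar 2)))))).

Definition excess_loop_cmd : cmd :=
  While (EVar 6)
    (Seq (Assign 10 (ECons (EHd (EVar 6)) (EVar 10)))
         (Assign 6 (ETl (EVar 6)))).

Definition reduction_cmd : cmd :=
  Seq (Assign 2 (EVar 0))
  (Seq max_loop_cmd
  (Seq (Assign 10 (ESing (ESing (ECons ETrue (EVar 1)))))
  (Seq (Assign 5 (EVar 1))
  (Seq units_loop_cmd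
  (Seq (Assign 6 (ESing (ESing (ECons ENil (EVar 1)))))
  (Seq (Assign 8 (EVar 0))
  (Seq (Assign 9 (ECons ENil (EVar 1)))
  (Seq cells_loop_cmd
  (Seq (Assign 9 ENil)
  (Seq (Assign 2 (EVar 0))
  (Seq checks_loop_cmd
  (Seq excess_loop_cmd
  (Seq (Assign 0 (ECons (EVar 10) (ESing (ECons ETrue (EVar 1)))))
  (Seq (Assign 1 ENil)
       (Assign 10 ENil))))))))))))))).

(** * Running times of the loops *)

Ltac run_block :=
  repeat first [apply: run_assign | apply: run_seq; [apply: run_assign|]].

Lemma run_subtract inp N cls c d n L L' R Y O :
  run subtract_cmd
    (state inp N cls c (code_nat d) (code_nat n) L L' R Y O)
    (state inp N cls c (code_nat (d - n)) Nil L L' R Y O) (8 * n + 2).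
Proof.
elim: n d => [|n IHn] d; first by rewrite subn0; apply: run_le (run_stop _ _) _.
apply: run_le; first apply: run_step => //; first by run_block.
  (* The tail of [Nil] is [Nil], which truncates the subtraction at 0. *)
  rewrite /= (_ : ttl (code_nat d) = code_nat d.-1); last by case: d.
  by rewrite (_ : d - n.+1 = d.-1 - n); [apply: IHn | lia].
by rewrite /=; lia.
Qed.

Lemma run_add inp n cls c d L L' R Y O :
  run add_cmd
    (state inp (code_nat n) cls c (code_nat d) Nil L L' R Y O)
    (state inp (code_nat (n + d)) cls c Nil Nil L L' R Y O) (9 * d + 2).
Proof.
elim: d n => [|d IHd] n; first by rewrite addn0; apply: run_le (run_stop _ _) _.
apply: run_le; first apply: run_step => //; first by run_block.
  by rewrite addnS -addSn; apply: (IHd n.+1).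
by rewrite /=; lia.
Qed.

(** The code of a formula does not record its number of variables; when all variables occur, this
    maximum, taken over all clauses, recovers it. *)
Definition max_var_clause (n : nat) (u : seq ulit) : nat :=
  foldl (fun n l => maxn n l.1.+1) n u.

Lemma max_var_clause_le N n u : n <= N -> bounded N u -> max_var_clause n u <= N.
Proof.
elim: u n => //= l u IHu n le_nN /andP[lt_lN bu].
by apply: IHu => //; rewrite geq_max le_nN.
Qed.

Lemma run_max_var_clause N inp n cls u L L' R Y O : n <= N -> bounded N u ->
  run max_clause_cmd
    (state inp (code_nat n) cls (code_uclause u) Nil Nil L L' R Y O)
    (state inp (code_nat (max_var_clause n u)) cls Nil Nil Nil L L' R Y O)
    (size u * (17 * N + 20) + 2).
Proof.
elim: u n => [|l u IHu] n le_nN; first by move=> _; apply: run_le (run_stop _ _) _.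
move=> /= /andP[lt_lN bu].
apply: run_le; first apply: run_step => //.
- apply: run_seq; first exact: run_assign.
  apply: run_seq; first exact: run_assign.
  apply: run_seq; first exact: (@run_subtract _ _ _ _ l.1.+1 n).
  apply: run_seq; first exact: run_add.
  exact: run_assign.
- by rewrite /= -maxnE; apply: IHu; rewrite // geq_max le_nN.
by rewrite /=; nia.
Qed.

Lemma run_max_loop N inp n us L L' R Y O : n <= N ->
  all (bounded N) us -> all (fun u => size u <= 3) us ->
  run max_loop_cmd
    (state inp (code_nat n) (code_ucnf us) Nil Nil Nil L L' R Y O)
    (state inp (code_nat (foldl max_var_clause n us)) Nil Nil Nil Nil L L' R Y O)
    (size us * (51 * N + 80) + 2).
Proof.
elim: us n => [|u us IHus] n le_nN; first by move=> *; apply: run_le (run_stop _ _) _.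
move=> /= /andP[bu b_us] /andP[su s_us].
apply: run_le; first apply: run_step => //.
- apply: run_seq; first exact: run_assign.
  apply: run_seq; first exact: run_max_var_clause le_nN bu.
  exact: run_assign.
- by apply: IHus; rewrite // max_var_clause_le.
by rewrite /=; nia.
Qed.

Lemma run_units inp N n cls c k L L' R Y us :
  run units_loop_cmd
    (state inp N cls c k (code_nat n) L L' R Y (code_ucnf us))
    (state inp N cls c k Nil L L' R Y (code_ucnf (unit_clauses n ++ us)))
    (30 * n + 2).
Proof.
elim: n us => [|n IHn] us; first by apply: run_le (run_stop _ _) _.
apply: run_le; first apply: run_step => //; first by run_block.
  have -> : unit_clauses n.+1 ++ us =
      unit_clauses n ++ [:: [:: (n, true)], [:: (n, false)] & us].
    by rewrite /unit_clauses -addn1 iotaD map_cat flatten_cat -catA.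
  exact: (IHn [:: [:: (n, true)], [:: (n, false)] & us]).
by rewrite /=; lia.
Qed.

Lemma run_extend inp N cls c k i r ws acc (R : seq tree) O :
  all (fun w => size w == r) ws ->
  run extend_cmd
    (state inp (code_nat N) cls c k i (code_ucnf (map (cell N) ws))
       (code_ucnf (map (cell N) acc)) (code_seq R) (code_nat (N.+1 + r)) O)
    (state inp (code_nat N) cls c k i Nil
       (code_ucnf (map (cell N)
          (foldl (fun acc w => (true :: w) :: (false :: w) :: acc) acc ws)))
       (code_seq (drop (size ws) R)) (code_nat (N.+1 + r)) O)
    (30 * size ws + 2).
Proof.
elim: ws acc R => [|w ws IHws] acc R.
  by move=> _; rewrite drop0; apply: run_le (run_stop _ _) _.
move=> /= /andP[/eqP sw s_ws].
apply: run_le; first apply: run_step => //; first by run_block.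
  have -> : drop (size ws).+1 R = drop (size ws) (behead R) by case: R.
  rewrite /= (_ : ttl (code_seq R) = code_seq (behead R)); last by case: (R).
  have := IHws ((true :: w) :: (false :: w) :: acc) (behead R) s_ws.
  rewrite /= sw; exact.
by rewrite /=; lia.
Qed.

(** Here [b] bounds the remaining rounds, each of which increases [2 ^ r]. A doubling takes place
    only if [2 ^ r <= size R], which bounds [2 ^ m]; the successor covers an empty [R], where
    nothing is doubled. *)
Lemma run_cells_loop inp N cls c k i (R : seq tree) O b r :
  (size R).+1 - 2 ^ r <= b -> 2 ^ r <= (2 * size R).+1 ->
  exists m, [/\ size R < 2 ^ m, 2 ^ m <= (2 * size R).+1 &
  run cells_loop_cmd
    (state inp (code_nat N) cls c k i (code_ucnf (map (cell N) (words r))) Nil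
       (code_seq (drop (2 ^ r).-1 R)) (code_nat (N.+1 + r)) O)
    (state inp (code_nat N) cls c k i (code_ucnf (map (cell N) (words m))) Nil
       Nil (code_nat (N.+1 + m)) O)
    (b * (30 * size R + 20) + 2)].
Proof.
elim: b r => [|b IHb] r le_b le_r.
  exists r; split=> //; first lia.
  rewrite drop_oversize; last lia.
  by apply: run_le (run_stop _ _) _.
have [le_R|lt_R] := leqP (2 ^ r) (size R); last first.
  exists r; split=> //; rewrite drop_oversize; last lia.
  by apply: run_le (run_stop _ _) _; rewrite //= leq_addl.
have [||m [lt_m le_m run_m]] := IHb r.+1.
- by rewrite expnS; have := expn_gt0 2 r; lia.
- by rewrite expnS; lia.
exists m; split=> //; apply: run_le; first apply: run_step.
- have : 0 < size (drop (2 ^ r).-1 R) by rewrite size_drop; have := expn_gt0 2 r; lia.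
  by rewrite /=; case: (drop _ R).
- apply: run_seq.
    apply: (@run_extend _ _ _ _ _ _ r _ [::]).
    by apply/allP=> w; rewrite words_mem.
  by run_block.
- rewrite /= drop_drop size_words.
  have -> : 2 ^ r + (2 ^ r).-1 = (2 ^ r.+1).-1 by rewrite expnS; have := expn_gt0 2 r; lia.
  by rewrite -[Cons Nil _]/(code_nat (N.+1 + r).+1) -addnS; apply: run_m.
by rewrite /= size_words; nia.
Qed.

Lemma run_checks_clause inp N cls u k i w us L' R Y O :
  run checks_clause_cmd
    (state inp N cls (code_uclause u) k i (Cons (code_uclause w) us) L' R Y (code_ucnf O))
    (state inp N cls Nil k i (Cons (code_uclause w) us) L' R Y
       (code_ucnf (catrev [seq l :: w | l <- u] O)))
    (20 * size u + 2).
Proof.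
elim: u O => [|l u IHu] O; first by apply: run_le (run_stop _ _) _.
apply: run_le; first apply: run_step => //; first by run_block.
  exact: (IHu ((l :: w) :: O)).
by rewrite /=; lia.
Qed.

Lemma run_checks_loop inp N us k i ws ws' L' R Y O :
  size ws = size us -> all (fun u => size u <= 3) us ->
  run checks_loop_cmd
    (state inp (code_nat N) (code_ucnf us) Nil k i
       (code_ucnf (map (cell N) (ws ++ ws'))) L' R Y (code_ucnf O))
    (state inp (code_nat N) Nil Nil k i
       (code_ucnf (map (cell N) ws')) L' R Y
       (code_ucnf (catrev [seq l :: cell N p.2 | p <- zip us ws, l <- p.1] O)))
    (100 * size us + 2).
Proof.
elim: us ws O => [|u us IHus] [|w ws] O //=.
  by move=> _ _; apply: run_le (run_stop _ _) _.
move=> [eq_size] /andP[su s_us]; apply: run_le; first apply: run_step => //.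
- apply: run_seq; first exact: run_assign.
  apply: run_seq; first exact: run_checks_clause.
  by run_block.
- by rewrite catrev_catl; apply: IHus.
by rewrite /=; nia.
Qed.

Lemma run_excess_loop inp N cls c k i us L' R Y O :
  run excess_loop_cmd
    (state inp N cls c k i (code_ucnf us) L' R Y (code_ucnf O))
    (state inp N cls c k i Nil L' R Y (code_ucnf (catrev us O)))
    (20 * size us + 2).
Proof.
elim: us O => [|u us IHus] O; first by apply: run_le (run_stop _ _) _.
apply: run_le; first apply: run_step => //; first by run_block.
  exact: (IHus (u :: O)).
by rewrite /=; lia.
Qed.

Lemma init_state inp :
  init_store inp = state inp Nil Nil Nil Nil Nil Nil Nil Nil Nil Nil.
Proof.
apply: functional_extensionality => y; rewrite /init_store /state.
by do 11?[case: y => [|y] //=]; rewrite nth_nil.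
Qed.

(** The auxiliary variables end up cleared, so the final store is an initial one for the next
    program. The square comes from the cells: a linear bound on the rounds times a linear cost per
    round. *)
Lemma run_reduction N us : N = foldl max_var_clause 0 us ->
  all (bounded N) us -> all (fun u => size u <= 3) us ->
  exists m, [/\ size us < 2 ^ m, 2 ^ m <= (2 * size us).+1 &
    run reduction_cmd (init_store (code_ucnf us))
      (init_store (Cons
         (code_ucnf (mus_clauses N us (take (size us) (words m))
                                       (drop (size us) (words m))))
         (code_uclause [:: (N, true)])))
      (1000 * (size us).+1 ^ 2 * N.+1)].
Proof.
move=> NE b_us s_us.
have [||m [lt_m le_m run_m]] :=
  @run_cells_loop (code_ucnf us) N Nil Nil Nil Nil (map code_uclause us)
    (code_ucnf (unit_clauses N ++ [:: [:: (N, true)]])) (size us) 0.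
- by rewrite size_map; lia.
- by [].
rewrite size_map in lt_m le_m run_m; exists m; split=> //.
rewrite !init_state; apply: run_le.
  apply: run_seq; first exact: run_assign.
  apply: run_seq; first exact: (@run_max_loop N _ 0).
  rewrite -NE; apply: run_seq; first exact: run_assign.
  apply: run_seq; first exact: run_assign.
  apply: run_seq; first exact: (@run_units _ _ N _ _ _ _ _ _ _ [:: [:: (N, true)]]).
  apply: run_seq; first exact: run_assign.
  apply: run_seq; first exact: run_assign.
  apply: run_seq; first exact: run_assign.
  apply: run_seq; first by move: run_m; rewrite drop0 addn0; apply.
  apply: run_seq; first exact: run_assign.
  apply: run_seq; first exact: run_assign.
  apply: run_seq.
    rewrite -{1}(cat_take_drop (size us) (words m)); apply: run_checks_loop => //.
    by rewrite size_takel // size_words ltnW.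
  apply: run_seq; first exact: run_excess_loop.
  by run_block.
rewrite /= size_map size_drop size_words; nia.
Qed.

(** * Time bounds *)

Lemma little_o_const a : little_o (fun=> a).
Proof. by move=> c; exists (c * a). Qed.

Lemma little_oD f g : little_o f -> little_o g -> little_o (fun n => f n + g n).
Proof.
move=> of_ og c; have [n1 n1P] := of_ (2 * c); have [n2 n2P] := og (2 * c).
exists (maxn n1 n2) => n; rewrite geq_max => /andP[/n1P + /n2P]; lia.
Qed.

Lemma little_oM f a : little_o f -> little_o (fun n => a * f n).
Proof. by move=> of_ c; have [n0 n0P] := of_ (c * a); exists n0 => n /n0P; rewrite mulnA. Qed.

(** [c * q n > n] would give [n ^ 2 < c ^ 2 * a * n.+1], which fails for large [n]. *)
Lemma little_o_sqrt q a n0 :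
  (forall n, n0 <= n -> q n ^ 2 <= a * n.+1) -> little_o q.
Proof.
move=> qP c; exists (n0 + (2 * (c ^ 2 * a)).+1) => n le_n.
rewrite leqNgt; apply/negP => lt_n.
have {}qP : q n ^ 2 <= a * n.+1 by apply: qP; lia.
have : n ^ 2 < (c * q n) ^ 2 by rewrite ltn_sqr.
rewrite expnMn ltnNge => /negP; apply.
apply: leq_trans (leq_mul (leqnn (c ^ 2)) qP) _; rewrite mulnA.
by move: (c ^ 2 * a) le_n => d; nia.
Qed.

(** The shift makes [2 ^ log n <= n.+1] hold at 0 as well. *)
Definition log (n : nat) : nat := trunc_log 2 n.+1.

Lemma exp_log n : 2 ^ log n <= n.+1.
Proof. by rewrite trunc_logP. Qed.

Lemma lt_exp_log n : n.+1 < 2 ^ (log n).+1.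
Proof. by rewrite trunc_log_ltn. Qed.

Lemma log_le n : log n <= n.
Proof. by have := leq_trans (ltn_expl (log n) (ltnSn 1)) (exp_log n). Qed.

Lemma little_o_log : little_o log.
Proof.
apply: (@little_o_sqrt _ 2 0) => n _.
apply: (@leq_trans (2 * 2 ^ log n)); last by rewrite leq_mul2l exp_log.
(* This is [k ^ 2 <= 2 * 2 ^ k]; from 3 on, [k.+1 ^ 2 <= 2 * k ^ 2]. *)
elim: (log n) => // k IHk; case: (leqP k 2) => [|lt_2k]; first by case: k {IHk} => [|[|[]]].
by rewrite (expnS 2 k); move: (2 ^ k) IHk => p; rewrite -!mulnn; nia.
Qed.

(** A monotone majorant: [f] need not be monotone, and the treewidth is only bounded from above. *)
Definition maxf (f : nat -> nat) (n : nat) : nat := \max_(i < n.+1) f i.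

Lemma leq_maxf f i n : i <= n -> f i <= maxf f n.
Proof. by rewrite -ltnS => lt_in; apply: (leq_bigmax (Ordinal lt_in)). Qed.

(** The maximum is attained either from [n0] on, where [f] is small, or before, where the constant
    [maxf f n0] bounds it. *)
Lemma little_o_maxf f : little_o f -> little_o (maxf f).
Proof.
move=> of_ c; have [n0 n0P] := of_ c; exists (c * maxf f n0) => n le_n.
have [i ->] : exists i : 'I_n.+1, maxf f n = f i.
  by have [|i] := @eq_bigmax _ (fun i : 'I_n.+1 => f i); [rewrite card_ord | exists i].
have [/n0P le_i|lt_i] := leqP n0 i.
  by apply: leq_trans le_i _; rewrite -ltnS.
by apply: leq_trans le_n; rewrite leq_mul2l leq_maxf ?orbT // ltnW.
Qed.

Lemma little_o_affine f a b : little_o f -> little_o (fun n => f (a.+1 * n + b)).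
Proof.
(* The factor absorbs slope and offset: [a.+1 * n + b <= (a + b).+1 * n] for positive [n]. *)
move=> of_ c; have [n0 n0P] := of_ (c * (a + b).+1); exists (n0 + b).+1 => n le_n.
have /n0P le_f : n0 <= a.+1 * n + b by nia.
rewrite -(@leq_pmul2l (a + b).+1) // mulnA (mulnC _ c).
by apply: leq_trans le_f _; nia.
Qed.

(** This tames the double exponential: eventually [2 * f (a.+1 * log n + b) <= log n + b], so the
    power of 2 is of order at most the square root of [n]. *)
Lemma little_o_exp f a b : little_o f ->
  little_o (fun n => 2 ^ f (a.+1 * log n + b)).
Proof.
move=> of_; have [k0 k0P] := of_ (2 * a.+1).
apply: (@little_o_sqrt _ (2 ^ b) (2 ^ k0)) => n le_n.
have le_k0 : k0 <= log n by rewrite /log trunc_log_max // leqW.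
have /k0P le_f : k0 <= a.+1 * log n + b by nia.
rewrite -expnM mulnC; apply: (@leq_trans (2 ^ b * 2 ^ log n)); last by rewrite leq_mul2l exp_log orbT.
rewrite -expnD leq_exp2l //; nia.
Qed.

(** * Parameters of the input formula *)

Lemma card_3clauses N (phi : cnf N) : is_3cnf phi -> #|phi| <= (2 * N).+1 ^ 3.
Proof.
(* [None] pads clauses with fewer than three literals, leaving [(2 * N).+1] choices for each of
   three positions. *)
move=> phi3; pose F (h : {ffun 'I_3 -> option (lit N)}) : clause N :=
  [set l | Some l \in codom h].
have sub : phi \subset F @: predT.
  apply/subsetP => c /phi3 c3; apply/imsetP.
  exists [ffun i : 'I_3 => nth None (map Some (enum c)) i] => //.
  apply/setP => l; rewrite inE; apply/idP/codomP => [lc|[i]].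
    have lt_i : index l (enum c) < size (enum c) by rewrite index_mem mem_enum.
    have lt_i3 : index l (enum c) < 3 by apply: leq_trans lt_i _; rewrite -cardE.
    by exists (Ordinal lt_i3); rewrite ffunE (nth_map l) // nth_index ?mem_enum.
  rewrite ffunE => /esym nthE; rewrite -mem_enum -(mem_map (@Some_inj _)) -nthE.
  rewrite mem_nth // ltnNge; apply/negP => le_i.
  by rewrite nth_default in nthE.
apply: leq_trans (subset_leq_card sub) (leq_trans (leq_imset_card _ _) _).
by rewrite card_ffun card_option card_prod card_bool !card_ord mulnC.
Qed.

Lemma max_var_clause_ge n u :
  n <= max_var_clause n u /\ forall l, l \in u -> l.1 < max_var_clause n u.
Proof.
elim: u n => [|l u IHu] n //=; have [le_n lt_u] := IHu (maxn n l.1.+1).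
rewrite geq_max in le_n; have /andP[le_nu lt_l] := le_n.
by split=> // l'; rewrite inE => /orP[/eqP->|/lt_u].
Qed.

Lemma foldl_max_var_ge n us : n <= foldl max_var_clause n us /\
  forall u l, u \in us -> l \in u -> l.1 < foldl max_var_clause n us.
Proof.
elim: us n => [|u us IHus] n //=; have [le_n lt_us] := IHus (max_var_clause n u).
have [le_nu lt_u] := max_var_clause_ge n u; split; first exact: leq_trans le_n.
move=> u' l; rewrite inE => /orP[/eqP->|u'_us]; last exact: lt_us.
by move=> /lt_u lt_l; apply: leq_trans le_n.
Qed.

Lemma foldl_max_var_le N n us : n <= N -> all (bounded N) us ->
  foldl max_var_clause n us <= N.
Proof.
elim: us n => //= u us IHus n le_n /andP[bu b_us].
by apply: IHus => //; apply: max_var_clause_le.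
Qed.

Lemma cnf_code_untyped N (phi : cnf N) a :
  is_3cnf phi -> all_vars_occur phi -> is_cnf_code phi a ->
  exists us, [/\ a = code_ucnf us, phi = cnf_of N us,
    [/\ all (bounded N) us, all uniq us & all (fun u => size u <= 3) us],
    N = foldl max_var_clause 0 us & size us <= (2 * N).+1 ^ 3].
Proof.
move=> phi3 vars_phi [s [s_uniq s_phi ->]]; pose us := map (map (@ulit_of N)) s.
have phiE : phi = cnf_of N us.
  apply/setP => c; rewrite inE -mem_enum -(perm_mem s_phi) -map_comp.
  by congr (_ \in _); apply: eq_map => c' /=; rewrite set_of_typed.
have b_us : all (bounded N) us.
  by apply/allP => _ /mapP[c _ ->]; apply/allP => _ /mapP[l _ ->] /=.
exists us; split=> //.
- rewrite /code_ucnf /us -map_comp; congr code_seq.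
  by apply: eq_map => c /=; rewrite code_typed.
- split=> //; apply/allP => _ /mapP[c cs ->].
    by rewrite map_inj_uniq ?(allP s_uniq) //; apply: ulit_of_inj.
  rewrite size_map -(card_uniqP (allP s_uniq c cs)) -cardsE; apply: phi3.
  by rewrite -mem_enum -(perm_mem s_phi) map_f.
- apply/eqP; rewrite eqn_leq foldl_max_var_le // andbT.
  have [N0|N_gt0] := posnP N; first by rewrite [X in X <= _]N0.
  (* The variable [N.-1] occurs in some clause, so the maximum is at least [N]. *)
  have lt_N : N.-1 < N by rewrite prednK.
  have := in_setT (Ordinal lt_N); rewrite -vars_phi => /bigcupP[c].
  rewrite phiE inE => /mapP[u u_us ->] /imsetP[l]; rewrite inE => lu lE.
  have [_ /(_ _ _ u_us lu)] := foldl_max_var_ge 0 us.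
  by rewrite /= -lE /= prednK.
- rewrite size_map -(size_map (fun c => [set l in c])) (perm_size s_phi).
  by rewrite -cardE card_3clauses.
Qed.

(** The time bound refers to the exact treewidth, while the star only gives an upper bound; the
    minimum is found classically. *)
Lemma treewidth_exists (V : finType) (e : rel V) k : treewidth_le e k ->
  exists2 k', is_treewidth e k' & k' <= k.
Proof.
elim/ltn_ind: k => k IHk tw_k.
have [[k' [lt_k' tw_k']]|no_less] := classic (exists k', k' < k /\ treewidth_le e k').
  have [k'' tw_k'' le_k''] := IHk k' lt_k' tw_k'; exists k'' => //.
  exact: leq_trans le_k'' (ltnW lt_k').
exists k => //; split=> // k' tw_k'; rewrite leqNgt; apply/negP => lt_k'.
by apply: no_less; exists k'.
Qed.

(** With [L = log N], one gets [M < 2 ^ (3 * L + 6)] and [m <= 3 * L + 7], hence [k <= 3 * L + 8]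
    and [n <= 4 * N + 8]. The last 1 in the exponent pays for adding two powers of 2. *)
Lemma time_bound (f g : nat -> nat) N M m n k :
  M <= (2 * N).+1 ^ 3 -> 2 ^ m <= (2 * M).+1 -> n = N + m.+1 -> k <= m.+1 ->
  1000 * M.+1 ^ 2 * N.+1 + 2 ^ (2 ^ f k) * 2 ^ g n <=
  2 ^ (7 * log N + 23 + 2 ^ maxf f (3 * log N + 8) + maxf g (4 * N + 8) + 1).
Proof.
move=> le_M le_m -> le_k; set L := log N.
have ltN : N.+1 <= 2 ^ L.+1 := ltnW (lt_exp_log N).
have ltM : M.+1 <= 2 ^ (3 * L + 6).
  apply: (@leq_trans ((2 * N.+1) ^ 3)); first by nia.
  rewrite (_ : 3 * L + 6 = L.+2 * 3); last by lia.
  by rewrite expnM leq_exp2r // expnS leq_mul2l.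
have ltm : m <= 3 * L + 7.
  rewrite -(@leq_exp2l 2) // addnS expnS; apply: leq_trans le_m _.
  by apply: leq_trans (leq_mul (leqnn 2) ltM); lia.
have le_f : f k <= maxf f (3 * L + 8) by apply: leq_maxf; lia.
have le_g : g (N + m.+1) <= maxf g (4 * N + 8).
  by apply: leq_maxf; have := log_le N; rewrite -/L; lia.
have le_red : 1000 * M.+1 ^ 2 * N.+1 <= 2 ^ (7 * L + 23).
  (* The summands bound, in this order, 1000, the square and [N.+1]. *)
  rewrite (_ : 7 * L + 23 = 10 + (3 * L + 6) * 2 + L.+1); last by lia.
  rewrite 2!expnD expnM !leq_mul // leq_exp2r //.
set x := 7 * L + 23 in le_red *; set y := 2 ^ maxf f _; set z := maxf g _ in le_g *.
have le_p : 2 ^ (2 ^ f k) * 2 ^ g (N + m.+1) <= 2 ^ (y + z).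
  by rewrite -expnD leq_exp2l // leq_add // leq_exp2l.
apply: leq_trans (leq_add le_red le_p) _.
rewrite addn1 expnS mul2n -addnn leq_add // leq_exp2l //; lia.
Qed.

(** * The reduction from 3SAT *)

Theorem theorem7p2 :
  ETH ->
  ~ exists (p : cmd) (f g : nat -> nat),
      [/\ little_o f,
          little_o g
        & solves_MUS_membership p (fun n k => 2 ^ (2 ^ f k) * 2 ^ g n)].
Proof.
move=> eth [p [f [g [of_ og solves_p]]]]; apply: eth.
(* The exponent is that of [time_bound], which covers both the reduction and the run of [p] on its
   output. *)
exists (Seq reduction_cmd p), (fun N =>
  7 * log N + 23 + 2 ^ maxf f (3 * log N + 8) + maxf g (4 * N + 8) + 1).
split.
  do 2?[apply: little_oD; last exact: little_o_const].
  apply: little_oD; last exact: (@little_o_affine _ 3 8 (little_o_maxf og)).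
  apply: little_oD; last exact: (@little_o_exp _ 2 8 (little_o_maxf of_)).
  apply: little_oD; last exact: little_o_const.
  exact: little_oM little_o_log.
move=> N phi a phi3 vars_phi /(cnf_code_untyped phi3 vars_phi).
case=> us [-> phiE [b_us u_us s_us] NE le_us].
have [m [lt_m le_m [r1 run_r1 le_r1]]] := run_reduction NE b_us s_us.
set ws := take _ _ in run_r1; set ws' := drop _ _ in run_r1.
have as_m : assigned N m us ws ws'.
  split=> //; first by rewrite size_takel // size_words ltnW.
    by rewrite cat_take_drop.
  by rewrite -size_eq0 size_drop size_words subn_eq0 -ltnNge.
have [k tw_k le_k] := treewidth_exists (mus_clauses_treewidth as_m).
have b_out := mus_clauses_bounded as_m.
have goal_out : [:: (N, true)] \in mus_clauses N us ws ws'.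
  exact/mem_mus_clauses/MusGoal.
have C_in : clause_of (N + m.+1) [:: (N, true)]
    \in cnf_of (N + m.+1) (mus_clauses N us ws ws').
  by rewrite inE map_f.
have [s [r2 [run_r2 le_r2 ans]]] := solves_p _ _ _ _ _ _
  (mus_clauses_vars as_m) tw_k C_in
  (cnf_code b_out (mus_clauses_all_uniq as_m) (mus_clauses_uniq as_m))
  (clause_code (allP b_out _ goal_out) isT).
exists s, (r1 + r2); split; first exact: exec_seq run_r1 run_r2.
  apply: leq_trans (leq_add le_r1 le_r2) _.
  exact: time_bound le_us le_m _ le_k.
rewrite {}ans; apply: (iff_trans (mus_clauses_correct as_m)).
by rewrite phiE; apply: (rwP (sat_cnf_of b_us)).
Qed.
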